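(* Let $n\ge3$ be an integer and $C>0$ a real number. Then there exists a triangulation of the sphere $\mathbb{S}^n$ (a finite simplicial complex whose geometric realization is homeomorphic to $\mathbb{S}^n$) whose $f$-vector satisfies $\frac{f_j}{f_i}>C$ for all integers $0\le i<j\le n$ with $i<\lfloor\frac{n-1}{2}\rfloor$.
   Context: For a finite simplicial complex $K$, its $f$-vector is the sequence $f_0,f_1,\ldots$, where $f_k$ is the number of $k$-dimensional simplices of $K$. *)

(* Defs.v *)
From HB Require Import structures.
From mathcomp Require Import all_boot all_order all_algebra.
From mathcomp Require Import all_classical all_reals all_analysis.
Set Implicit Arguments.
Unset Strict Implicit.
Unset Printing Implicit Defensive.
Import Order.TTheory GRing.Theory Num.Theory.
Import numFieldNormedType.Exports.
Local Open Scope classical_set_scope.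
Local Open Scope ring_scope.

(* The vertices of K are the i with {i} \in K; other elements of 'I_m are in no
   simplex and play no role.  The empty set does not count as a simplex. *)
Definition simplicial_complex (m : nat) (K : {set {set 'I_m}}) : Prop :=
  finset.set0 \notin K /\
  forall s t : {set 'I_m},
    s \in K -> t \subset s -> t != finset.set0 -> t \in K.

Definition fvec (m : nat) (K : {set {set 'I_m}}) (k : nat) : nat :=
  #|[set s : {set 'I_m} in K | #|s| == k.+1]%SET|.

(* The points of R^m in barycentric coordinates, vertex i being sent to the
   i-th vector of the standard basis: the union, over the simplices s of K, of
   the convex hulls of the basis vectors indexed by s. *)
Definition realization (R : realType) (m : nat) (K : {set {set 'I_m}}) :
    set 'rV[R]_m :=
  [set x | exists2 s : {set 'I_m}, s \in K &
    [/\ forall i, 0 <= x ord0 i,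
        \sum_i x ord0 i = 1
      & forall i, i \notin s -> x ord0 i = 0]].

Arguments realization R {m} K.

Definition unit_sphere (R : realType) (n : nat) : set 'rV[R]_n.+1 :=
  [set x | \sum_i x ord0 i ^+ 2 = 1].

Arguments unit_sphere R n : clear implicits.

(* A and B, with their subspace topologies, are homeomorphic; the values of f
   outside A and of g outside B are irrelevant. *)
Definition homeomorphic (T U : topologicalType) (A : set T) (B : set U) : Prop :=
  exists (f : T -> U) (g : U -> T),
    [/\ set_fun A B f, set_fun B A g,
        {in A, cancel f g} /\ {in B, cancel g f},
        {within A, continuous f}
      & {within B, continuous g}].

Definition triangulates_sphere (R : realType) (n m : nat)
    (K : {set {set 'I_m}}) : Prop :=
  simplicial_complex K /\ homeomorphic (realization R K) (unit_sphere R n).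

(* Main.v *)
(* Realize a complex in barycentric coordinates and take the cone over it with
   apex the origin, the set of nonnegative vectors whose support is a face or
   empty. A positively homogeneous homeomorphism between this cone and R^d gives,
   after normalizing on both sides, a homeomorphism of the complex with the
   (d-1)-sphere. Such homeomorphisms multiply under joins and survive edge
   subdivision, with globally defined formulas, so no gluing is needed.
   Starting from the two-point sphere one gets polygons with p + 4 vertices, and then
   the join of k such polygons, suspended if n = 2k is even. Choosing one vertex
   (or one edge) in each polygon gives at least p^min(t,k) faces with t vertices,
   while there are at most N^t of them, N = O(p) being the number of vertices.
   So f_j / f_i grows at least like p when i < j and i + 2 <= k. *)
Require Import Defs.
From mathcomp Require Import all_boot all_order all_algebra.
From mathcomp Require Import all_classical all_reals all_analysis.
From mathcomp Require Import lra zify.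
Set Implicit Arguments.
Unset Strict Implicit.
Unset Printing Implicit Defensive.
Import Order.TTheory GRing.Theory Num.Theory.
Import numFieldNormedType.Exports.
Local Open Scope ring_scope.

(** * Cones over complexes and their homogeneous parametrizations *)

Lemma continuous_row (T : topologicalType) (R : numFieldType) (d : nat)
    (f : T -> 'rV[R]_d) (x : T) :
  (forall j, {for x, continuous (fun t => f t ord0 j)}) -> {for x, continuous f}.
Proof.
move=> cf A [P nP sPA].
(* Finitely many coordinate neighbourhoods are intersected, by induction on the list of indices. *)
have H : \forall t \near x, forall j, j \in enum 'I_d -> P ord0 j (f t ord0 j).
  elim: (enum 'I_d) => [|j s IH]; first by apply: nearW.
  have cj := cf j _ (nP ord0 j).
  near=> t => k; rewrite inE => /orP[/eqP ->|]; first by near: t.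
  by move: k; near: t.
apply: filterS H => t Pt; apply: sPA => i j.
by rewrite ord1; apply: Pt; rewrite mem_enum.
Unshelve. all: by end_near. Qed.

Definition supp (R : realType) (m : nat) (x : 'rV[R]_m) : {set 'I_m} :=
  [set i | x ord0 i != 0]%SET.

(* Unlike in [simplicial_complex], the empty set is a face: the cone then
   contains the origin, and joins need no case distinction. *)
Definition down_closed (m : nat) (D : {set {set 'I_m}}) : Prop :=
  finset.set0 \in D /\
  forall s t : {set 'I_m}, s \in D -> t \subset s -> t \in D.

Definition cone (R : realType) (m : nat) (D : {set {set 'I_m}}) (x : 'rV[R]_m) :
    Prop :=
  (forall i, 0 <= x ord0 i) /\ supp x \in D.

(** The value [c = 0] is allowed, so such a map fixes the origin. *)
Definition pos_homogeneous (R : realType) (m d : nat)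
    (f : 'rV[R]_m -> 'rV[R]_d) : Prop :=
  forall (c : R) x, 0 <= c -> f (c *: x) = c *: f x.

(** Both maps are continuous on the whole ambient space, so no subspace topology enters before the
    passage to the sphere. Only [g (f x) = x] is restricted to the cone. *)
Definition cone_space (R : realType) (m : nat) (D : {set {set 'I_m}}) (d : nat) :
    Prop :=
  exists (f : 'rV[R]_m -> 'rV[R]_d) (g : 'rV[R]_d -> 'rV[R]_m),
    [/\ continuous f /\ continuous g,
        pos_homogeneous f /\ pos_homogeneous g,
        forall y, cone D (g y), cancel g f
      & forall x, cone D x -> g (f x) = x].

Arguments cone_space R {m} D d.

(* Indexed by the number of vertices: [faces D k.+1] counts the k-simplices. *)
Definition faces (m : nat) (D : {set {set 'I_m}}) (t : nat) : nat :=
  #|[set s in D | #|s| == t]%SET|.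

(** * From the cone to the sphere *)

Lemma fvecD1 (m : nat) (D : {set {set 'I_m}}) (k : nat) :
  fvec (D :\ finset.set0)%SET k = faces D k.+1.
Proof.
rewrite /fvec /faces; congr (#|pred_of_set _|); apply/setP => s; rewrite !inE.
by case: eqVneq => //= ->; rewrite cards0 andbF.
Qed.

Lemma sum_pos_neq0 (R : realType) (m : nat) (x : 'rV[R]_m) :
  (forall i, 0 <= x ord0 i) -> x != 0 -> 0 < \sum_i x ord0 i.
Proof.
move=> x0 xn0; rewrite lt0r sumr_ge0 // andbT.
apply: contra xn0; rewrite psumr_eq0 // => /allP h.
apply/eqP/rowP => i; rewrite mxE; apply/eqP.
by apply: h; rewrite mem_index_enum.
Qed.

Lemma suppZ (R : realType) (m : nat) (c : R) (x : 'rV[R]_m) :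
  c != 0 -> supp (c *: x) = supp x.
Proof. by move=> c0; apply/setP => i; rewrite !inE mxE mulf_eq0 negb_or c0. Qed.

(** Coordinate sum 1 excludes the origin, the only point with empty support, so discarding the empty
    face loses nothing. *)
Lemma cone_realization (R : realType) (m : nat) (D : {set {set 'I_m}})
    (x : 'rV[R]_m) : down_closed D ->
  realization R (D :\ finset.set0)%SET x <-> cone D x /\ \sum_i x ord0 i = 1.
Proof.
move=> [D0 dD]; split=> [[s]|[[x0 sx] x1]].
  rewrite !inE => /andP[_ sD] [x0 x1 xs]; split=> //; split=> //.
  apply: dD sD _; apply/fintype.subsetP => i; rewrite inE; apply: contraR => /xs ->.
  exact: eqxx.
exists (supp x); last first.
  by split=> // i; rewrite inE negbK => /eqP.
rewrite !inE sx andbT; apply/eqP => s0.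
suff: \sum_i x ord0 i = 0 by rewrite x1; exact/eqP/oner_neq0.
apply: big1 => i _; apply/eqP; move/setP/(_ i): s0; rewrite !inE.
by move/negbFE.
Qed.

Lemma continuous_coord_sum (R : realType) (m : nat) (h : R -> R) :
  continuous h -> continuous (fun x : 'rV[R]_m => \sum_i h (x ord0 i)).
Proof.
move=> ch; apply: continuous_big => [|i _]; first exact: add_continuous.
move=> x; apply: (@continuous_comp _ _ _ (fun x : 'rV[R]_m => x ord0 i) h).
  exact: coord_continuous.
exact: ch.
Qed.

Lemma continuous_scale_inv (R : realType) (m d : nat) (x : 'rV[R]_m)
    (f : 'rV[R]_m -> 'rV[R]_d) (N : 'rV[R]_d -> R) :
  {for x, continuous f} -> {for f x, continuous N} -> N (f x) != 0 ->
  {for x, continuous (fun x => (N (f x))^-1 *: f x)}.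
Proof.
move=> cf cN N0; apply: continuous_row => j.
have -> : (fun t => ((N (f t))^-1 *: f t) ord0 j) =
    (fun t => (N (f t))^-1 * f t ord0 j) by apply: funext => t; rewrite mxE.
have cNf := @continuous_comp _ _ _ f N x cf cN.
have cfj := @continuous_comp _ _ _ f (fun y : 'rV[R]_d => y ord0 j) x cf
  (@coord_continuous _ _ _ ord0 j _).
exact: (cvgM (cvgV N0 cNf) cfj).
Qed.

(** Apply [f] and rescale to Euclidean norm 1; apply [g] and rescale to coordinate sum 1. By
    homogeneity the scaling factors pass through [f] and [g] and cancel. *)
Lemma cone_space_sphere (R : realType) (m n : nat) (D : {set {set 'I_m}}) :
  down_closed D -> cone_space R D n.+1 ->
  triangulates_sphere R n (D :\ finset.set0)%SET.
Proof.
move=> dD [f [g [[cf cg] [hf hg] gD gK fK]]]; split.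
  split=> [|s t]; rewrite !inE ?eqxx // => /andP[_ sD] ts t0.
  by rewrite t0; apply: dD.2 ts.
have cone0 : cone D (0 : 'rV[R]_m).
  split=> [i|]; first by rewrite mxE.
  rewrite (_ : supp _ = finset.set0) ?dD.1 //.
  by apply/setP => i; rewrite !inE mxE eqxx.
have f0 : f 0 = 0 by rewrite -(scale0r 0) hf // scale0r.
have g0 : g 0 = 0 by rewrite -f0 fK.
pose N (y : 'rV[R]_n.+1) := Num.sqrt (\sum_i y ord0 i ^+ 2).
pose S (x : 'rV[R]_m) := \sum_i x ord0 i.
have cN : continuous N.
  move=> y; apply: (@continuous_comp _ _ _
    (fun y : 'rV[R]_n.+1 => \sum_i y ord0 i ^+ 2) Num.sqrt).
    exact: (continuous_coord_sum (@exprn_continuous R 2)).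
  exact: sqrt_continuous.
have cS : continuous S by apply: (@continuous_coord_sum R m id); move=> ?.
have N0 y : y != 0 -> 0 < N y.
  move=> yn0; rewrite sqrtr_gt0 lt0r sumr_ge0 ?andbT => [|i _]; last exact: sqr_ge0.
  apply: contra yn0; rewrite psumr_eq0 => [/allP h|i _]; last exact: sqr_ge0.
  apply/eqP/rowP => i; rewrite mxE; apply/eqP; rewrite -sqrf_eq0.
  by apply: h; rewrite mem_index_enum.
have NZ c y : 0 <= c -> N (c *: y) = c * N y.
  move=> c0; rewrite /N -[c in RHS](@ger0_norm R) // -sqrtr_sqr -sqrtrM ?sqr_ge0 //.
  by congr Num.sqrt; rewrite mulr_sumr; apply: eq_bigr => i _; rewrite mxE exprMn.
have SZ c x : S (c *: x) = c * S x.
  by rewrite /S mulr_sumr; apply: eq_bigr => i _; rewrite mxE.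
(* On the cone [f] vanishes only at the origin, because [g] inverts it there and [g 0 = 0]. *)
have fn0 x : realization R (D :\ finset.set0)%SET x -> f x != 0.
  move/(cone_realization _ dD) => [cx x1]; apply/eqP => fx0.
  have xE : x = 0 by rewrite -(fK x) // fx0 g0.
  by move: x1; rewrite xE big1 => [/esym/eqP|i _]; rewrite ?oner_eq0 // mxE.
have yn0 y : unit_sphere R n y -> y != 0.
  move=> y1; apply/eqP => y0; move: y1; rewrite y0 /unit_sphere /= big1 => [/esym/eqP|i _].
    by rewrite oner_eq0.
  by rewrite mxE expr0n.
have gn0 y : unit_sphere R n y -> 0 < S (g y).
  move=> /yn0 y0; apply: sum_pos_neq0; first exact: (gD y).1.
  by apply: contra y0 => /eqP g0'; rewrite -(gK y) g0' f0.
have Nsph y : unit_sphere R n y -> N y = 1.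
  by rewrite /unit_sphere /= /N => ->; rewrite sqrtr1.
exists (fun x => (N (f x))^-1 *: f x), (fun y => (S (g y))^-1 *: g y); split.
- move=> x /fn0 /N0 Nx; rewrite /unit_sphere /=.
  have : N ((N (f x))^-1 *: f x) = 1 by rewrite NZ ?invr_ge0 1?ltW // mulVf // gt_eqF.
  move/(congr1 (fun z => z ^+ 2)); rewrite expr1n sqr_sqrtr //.
  by apply: sumr_ge0 => i _; exact: sqr_ge0.
- move=> y /gn0 Sy; apply/(cone_realization _ dD); split; last first.
    by rewrite -/(S _) SZ mulVf // gt_eqF.
  split=> [i|]; last by rewrite suppZ ?(gD y).2 // invr_eq0 gt_eqF.
  by rewrite mxE mulr_ge0 ?(gD y).1 // invr_ge0 ltW.
- split=> [x|y]; rewrite inE => h.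
    (* Here [g] returns [x / N (f x)]; since [S x = 1], its coordinate sum is [1 / N (f x)], and
       normalizing recovers [x]. *)
    have Nx := N0 _ (fn0 _ h); have [cx x1] := (cone_realization _ dD).1 h.
    rewrite hg ?invr_ge0 1?ltW // fK // SZ [S x]x1 mulr1 scalerA invrK mulfV ?scale1r //.
    by rewrite gt_eqF.
  have Sy := gn0 _ h; rewrite hf ?invr_ge0 1?ltW // gK NZ ?invr_ge0 1?ltW //.
  by rewrite Nsph // mulr1 scalerA invrK mulfV ?scale1r // gt_eqF.
- apply: continuous_in_subspaceT => x; rewrite inE => /fn0 /N0 Nx.
  by apply: continuous_scale_inv; [exact: cf|exact: cN|rewrite gt_eqF].
- apply: continuous_in_subspaceT => y; rewrite inE => /gn0 Sy.
  by apply: continuous_scale_inv; [exact: cg|exact: cS|rewrite gt_eqF].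
Qed.

(** * Joins *)

Definition lpart (m1 m2 : nat) (s : {set 'I_(m1 + m2)}) : {set 'I_m1} :=
  [set i | lshift m2 i \in s]%SET.

Definition rpart (m1 m2 : nat) (s : {set 'I_(m1 + m2)}) : {set 'I_m2} :=
  [set i | rshift m1 i \in s]%SET.

Definition join (m1 m2 : nat) (D1 : {set {set 'I_m1}}) (D2 : {set {set 'I_m2}}) :
    {set {set 'I_(m1 + m2)}} :=
  [set s | (lpart s \in D1) && (rpart s \in D2)]%SET.

Lemma lpart0 (m1 m2 : nat) : lpart (finset.set0 : {set 'I_(m1 + m2)}) = finset.set0.
Proof. by apply/setP => i; rewrite !inE. Qed.

Lemma rpart0 (m1 m2 : nat) : rpart (finset.set0 : {set 'I_(m1 + m2)}) = finset.set0.
Proof. by apply/setP => i; rewrite !inE. Qed.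

Lemma lpartS (m1 m2 : nat) (s t : {set 'I_(m1 + m2)}) :
  s \subset t -> lpart s \subset lpart t.
Proof.
move=> /fintype.subsetP st.
by apply/fintype.subsetP => i; rewrite !inE => /st.
Qed.

Lemma rpartS (m1 m2 : nat) (s t : {set 'I_(m1 + m2)}) :
  s \subset t -> rpart s \subset rpart t.
Proof.
move=> /fintype.subsetP st.
by apply/fintype.subsetP => i; rewrite !inE => /st.
Qed.

Lemma lpart_supp (R : realType) (m1 m2 : nat) (x : 'rV[R]_(m1 + m2)) :
  lpart (supp x) = supp (lsubmx x).
Proof. by apply/setP => i; rewrite !inE mxE. Qed.

Lemma rpart_supp (R : realType) (m1 m2 : nat) (x : 'rV[R]_(m1 + m2)) :
  rpart (supp x) = supp (rsubmx x).
Proof. by apply/setP => i; rewrite !inE mxE. Qed.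

Lemma continuous_lsubmx (R : realType) (m1 m2 : nat) :
  continuous (lsubmx : 'rV[R]_(m1 + m2) -> 'rV[R]_m1).
Proof.
move=> x; apply: continuous_row => j.
rewrite (_ : (fun t : 'rV[R]_(m1 + m2) => _) = fun t => t ord0 (lshift m2 j)).
  exact: coord_continuous.
by apply: funext => t; rewrite mxE.
Qed.

Lemma continuous_rsubmx (R : realType) (m1 m2 : nat) :
  continuous (rsubmx : 'rV[R]_(m1 + m2) -> 'rV[R]_m2).
Proof.
move=> x; apply: continuous_row => j.
rewrite (_ : (fun t : 'rV[R]_(m1 + m2) => _) = fun t => t ord0 (rshift m1 j)).
  exact: coord_continuous.
by apply: funext => t; rewrite mxE.
Qed.

Lemma continuous_row_mx (T : topologicalType) (R : realType) (m1 m2 : nat)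
    (f1 : T -> 'rV[R]_m1) (f2 : T -> 'rV[R]_m2) :
  continuous f1 -> continuous f2 -> continuous (fun x => row_mx (f1 x) (f2 x)).
Proof.
move=> c1 c2 x; apply: continuous_row => j; case: (split_ordP j) => k ->.
  rewrite (_ : (fun t : T => _) = (fun y : 'rV[R]_m1 => y ord0 k) \o f1).
    by apply: continuous_comp; [exact: c1|exact: coord_continuous].
  by apply: funext => t; rewrite row_mxEl.
rewrite (_ : (fun t : T => _) = (fun y : 'rV[R]_m2 => y ord0 k) \o f2).
  by apply: continuous_comp; [exact: c2|exact: coord_continuous].
by apply: funext => t; rewrite row_mxEr.
Qed.

Lemma lsubmxZ (R : realType) (m1 m2 : nat) (c : R) (x : 'rV[R]_(m1 + m2)) :
  lsubmx (c *: x) = c *: lsubmx x.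
Proof. by apply/rowP => i; rewrite !mxE. Qed.

Lemma rsubmxZ (R : realType) (m1 m2 : nat) (c : R) (x : 'rV[R]_(m1 + m2)) :
  rsubmx (c *: x) = c *: rsubmx x.
Proof. by apply/rowP => i; rewrite !mxE. Qed.

Lemma cone_join (R : realType) (m1 m2 : nat) (D1 : {set {set 'I_m1}})
    (D2 : {set {set 'I_m2}}) (x : 'rV[R]_(m1 + m2)) :
  cone (join D1 D2) x <-> cone D1 (lsubmx x) /\ cone D2 (rsubmx x).
Proof.
rewrite /cone inE lpart_supp rpart_supp; split.
  by move=> [x0 /andP[-> ->]]; split; split=> // i; rewrite mxE.
move=> [[l0 ->] [r0 ->]]; split=> // i; case: (split_ordP i) => k ->.
  by have := l0 k; rewrite mxE.
by have := r0 k; rewrite mxE.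
Qed.

Lemma down_closed_join (m1 m2 : nat) (D1 : {set {set 'I_m1}})
    (D2 : {set {set 'I_m2}}) :
  down_closed D1 -> down_closed D2 -> down_closed (join D1 D2).
Proof.
move=> [z1 d1] [z2 d2]; split=> [|s t]; first by rewrite inE lpart0 rpart0 z1.
rewrite !inE => /andP[ls rs] ts.
by rewrite (d1 _ _ ls (lpartS ts)) (d2 _ _ rs (rpartS ts)).
Qed.

(** The cone over a join is the product of the two cones, so the given maps act side by side on the
    two blocks of coordinates. *)
Lemma cone_space_join (R : realType) (m1 m2 d1 d2 : nat)
    (D1 : {set {set 'I_m1}}) (D2 : {set {set 'I_m2}}) :
  cone_space R D1 d1 -> cone_space R D2 d2 ->
  cone_space R (join D1 D2) (d1 + d2).
Proof.
move=> [f1 [g1 [[cf1 cg1] [hf1 hg1] gD1 gK1 fK1]]].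
move=> [f2 [g2 [[cf2 cg2] [hf2 hg2] gD2 gK2 fK2]]].
exists (fun x => row_mx (f1 (lsubmx x)) (f2 (rsubmx x))).
exists (fun y => row_mx (g1 (lsubmx y)) (g2 (rsubmx y))); split.
- split; apply: continuous_row_mx => x; apply: continuous_comp;
    by [exact: continuous_lsubmx|exact: continuous_rsubmx
       |exact: cf1|exact: cf2|exact: cg1|exact: cg2].
- split=> c x c0; rewrite lsubmxZ rsubmxZ scale_row_mx.
    by rewrite hf1 // hf2.
  by rewrite hg1 // hg2.
- by move=> y; apply/cone_join; rewrite row_mxKl row_mxKr.
- by move=> y; rewrite row_mxKl row_mxKr gK1 gK2 hsubmxK.
- move=> x /cone_join [cl cr].
  by rewrite row_mxKl row_mxKr fK1 // fK2 // hsubmxK.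
Qed.

Definition join_set (m1 m2 : nat) (s : {set 'I_m1}) (t : {set 'I_m2}) :
    {set 'I_(m1 + m2)} :=
  ((@lshift m1 m2 @: s) :|: (@rshift m1 m2 @: t))%SET.

Lemma lpart_join_set (m1 m2 : nat) (s : {set 'I_m1}) (t : {set 'I_m2}) :
  lpart (join_set s t) = s.
Proof.
apply/setP => i; rewrite !inE (mem_imset _ _ (@lshift_inj _ _)).
case: imsetP => [[k _ /eqP]|]; last by rewrite orbF.
by rewrite eq_lrshift.
Qed.

Lemma rpart_join_set (m1 m2 : nat) (s : {set 'I_m1}) (t : {set 'I_m2}) :
  rpart (join_set s t) = t.
Proof.
apply/setP => i; rewrite !inE (mem_imset _ _ (@rshift_inj _ _)).
case: imsetP => [[k _ /eqP]|//].
by rewrite eq_rlshift.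
Qed.

Lemma card_join_set (m1 m2 : nat) (s : {set 'I_m1}) (t : {set 'I_m2}) :
  #|join_set s t| = (#|s| + #|t|)%N.
Proof.
rewrite cardsU (card_imset _ (@lshift_inj _ _)) (card_imset _ (@rshift_inj _ _)).
rewrite (_ : (_ :&: _)%SET = finset.set0) ?cards0 ?subn0 //.
apply/setP => i; rewrite !inE; apply/negP => /andP[/imsetP[a _ ->] /imsetP[b _ /eqP]].
by rewrite eq_lrshift.
Qed.

Lemma join_set_inj (m1 m2 : nat) :
  injective (fun p : {set 'I_m1} * {set 'I_m2} => join_set p.1 p.2).
Proof.
move=> [s t] [s' t'] /= e.
have := congr1 (@rpart m1 m2) e; rewrite !rpart_join_set => ->.
by have := congr1 (@lpart m1 m2) e; rewrite !lpart_join_set => ->.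
Qed.

(** Distinct pairs of faces have distinct unions. Only one way of splitting [a + b] is counted,
    hence an inequality. *)
Lemma faces_join (m1 m2 a b : nat) (D1 : {set {set 'I_m1}})
    (D2 : {set {set 'I_m2}}) :
  (faces D1 a * faces D2 b <= faces (join D1 D2) (a + b))%N.
Proof.
rewrite /faces -cardsX -(card_imset _ (@join_set_inj m1 m2)).
apply: subset_leq_card; apply/fintype.subsetP => u /imsetP[[s t]].
rewrite !inE /= => /andP[/andP[s1 /eqP s2] /andP[t1 /eqP t2]] ->.
by rewrite lpart_join_set rpart_join_set card_join_set s1 t1 s2 t2 eqxx.
Qed.

Lemma faces0 (m : nat) (D : {set {set 'I_m}}) : down_closed D -> faces D 0 = 1%N.
Proof.
move=> [D0 _]; rewrite /faces (_ : finset _ = [set finset.set0]%SET) ?cards1 //.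
apply/setP => s; rewrite !inE cards_eq0 andbC.
by case: eqVneq => // ->; rewrite D0.
Qed.

(** The faces are among the [t]-subsets of the vertices, and a binomial coefficient is at most the
    falling factorial, hence at most the power. *)
Lemma faces_le (m : nat) (D : {set {set 'I_m}}) (t : nat) : (faces D t <= m ^ t)%N.
Proof.
apply: (@leq_trans 'C(m, t)).
  rewrite -[X in 'C(X, _)](card_ord m) -card_draws; apply: subset_leq_card.
  by apply/fintype.subsetP => s; rewrite !inE => /andP[].
apply: (@leq_trans (m ^_ t)).
  by rewrite -bin_ffact leq_pmulr // fact_gt0.
elim: t m {D} => [|t IH] [|m]; rewrite ?ffactn0 ?ffact0n //.
rewrite ffactSS expnS leq_mul //.
by apply: leq_trans (IH m) _; case: {IH}t => // t; rewrite leq_exp2r.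
Qed.

(** * Edge subdivision *)

(** Stellar subdivision of the edge uv, with [rshift m ord0] as the new vertex w. Faces containing
    the edge disappear, and w is joined to those remaining faces that span a face of [D] together
    with the edge. *)
Definition subdivide (m : nat) (u v : 'I_m) (D : {set {set 'I_m}}) :
    {set {set 'I_(m + 1)}} :=
  [set s | [&& lpart s \in D, ~~ ([set u; v] \subset lpart s) &
    (rshift m ord0 \in s) ==> ([set u; v] :|: lpart s \in D)]]%SET.

Lemma down_closed_subdivide (m : nat) (u v : 'I_m) (D : {set {set 'I_m}}) :
  down_closed D -> down_closed (subdivide u v D).
Proof.
move=> [z d]; split=> [|s t].
  rewrite !inE lpart0 z /= andbT; apply/fintype.subsetPn; exists u.
    by rewrite !inE eqxx.
  by rewrite inE.
rewrite !inE => /and3P[Ds uvs /implyP ws] ts; apply/and3P; split.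
- exact: d Ds (lpartS ts).
- by apply: contra uvs => /fintype.subset_trans; apply; exact: lpartS.
- apply/implyP => wt; apply: (d _ _ (ws _)); last by rewrite finset.setUS ?lpartS.
  exact: (fintype.subsetP ts).
Qed.

Definition edge_indicator (R : realType) (m : nat) (u v : 'I_m) : 'rV[R]_m :=
  \row_i ((i == u) || (i == v))%:R.

(* The new vertex w is sent to e_u + e_v. Backwards, the coordinates at u and v
   release their common part min(x_u, x_v), which goes to w. *)
Lemma cone_space_subdivide (R : realType) (m d : nat) (u v : 'I_m)
    (D : {set {set 'I_m}}) : down_closed D -> u != v ->
  cone_space R D d -> cone_space R (subdivide u v D) d.
Proof.
move=> dD uv [f [g [[cf cg] [hf hg] gD gK fK]]].
pose e := edge_indicator R u v.
have eE i : e ord0 i = ((i == u) || (i == v))%:R by rewrite mxE.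
pose p (x : 'rV[R]_(m + 1)) := lsubmx x + x ord0 (rshift m ord0) *: e.
pose mn (x : 'rV[R]_m) := Num.min (x ord0 u) (x ord0 v).
pose q (x : 'rV[R]_m) : 'rV[R]_(m + 1) := row_mx (x - mn x *: e) (const_mx (mn x)).
have cp : continuous p.
  move=> x; have cl := @continuous_lsubmx R m 1 x.
  have cw := @coord_continuous R 1 (m + 1) ord0 (rshift m ord0) x.
  exact: (cvgD cl (cvgZr_tmp (a := e) cw)).
have cmn : continuous mn.
  by move=> x; apply: continuous_min; exact: coord_continuous.
have cq : continuous q.
  apply: continuous_row_mx => x.
    exact: (cvgB (@cvg_id _ (nbhs x)) (cvgZr_tmp (a := e) (cmn x))).
  apply: continuous_row => j.
  rewrite (_ : (fun t : 'rV[R]_m => _) = mn); first exact: cmn.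
  by apply: funext => t; rewrite mxE.
have hp : pos_homogeneous p.
  by move=> c x c0; rewrite /p lsubmxZ mxE scalerDr scalerA.
have hmn c x : 0 <= c -> mn (c *: x) = c * mn x.
  by move=> c0; rewrite /mn !mxE minr_pMr.
have hq : pos_homogeneous q.
  move=> c x c0; rewrite /q hmn // scale_row_mx scalerBr scalerA; congr row_mx.
  by apply/rowP => i; rewrite !mxE.
have qK x : p (q x) = x by rewrite /p row_mxKl row_mxEr mxE subrK.
have qD x : cone D x -> cone (subdivide u v D) (q x).
  move=> [x0 sx].
  have mn0 : 0 <= mn x by rewrite /mn le_min !x0.
  have mnl i : mn x * e ord0 i <= x ord0 i.
    rewrite eE; case: eqVneq => [->|_] /=.
      by rewrite mulr1 /mn ge_min lexx.
    case: eqVneq => [->|_] /=; last by rewrite mulr0.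
    by rewrite mulr1 /mn ge_min lexx orbT.
  have sub : supp (x - mn x *: e) \subset supp x.
    apply/fintype.subsetP => i; rewrite !inE; apply: contra => /eqP xi.
    have := mnl i; rewrite xi !mxE => h.
    by rewrite xi sub0r oppr_eq0 eq_le h mulr_ge0.
  split=> [i|].
    case: (split_ordP i) => k ->; last by rewrite row_mxEr mxE.
    by have := mnl k; rewrite row_mxEl !mxE subr_ge0.
  rewrite inE lpart_supp row_mxKl; apply/and3P; split.
  - exact: dD.2 sx sub.
  (* The coordinate attaining the minimum drops to 0, so u or v leaves the support. *)
  - apply/fintype.subsetPn.
    have : (mn x == x ord0 u) || (mn x == x ord0 v).
      by rewrite /mn; case: ltP; rewrite eqxx ?orbT.
    case/orP => /eqP h; [exists u|exists v]; rewrite !inE ?eqxx ?orbT // !mxE.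
      by rewrite eqxx mulr1 h subrr eqxx.
    by rewrite eqxx orbT mulr1 h subrr eqxx.
  (* If w carries mass, the minimum is positive, so u and v both lie in [supp x]. *)
  - apply/implyP; rewrite inE row_mxEr mxE => mnn0.
    have {}mn0 : 0 < mn x by rewrite lt0r mnn0.
    apply: dD.2 sx _; rewrite finset.subUset sub andbT.
    by move: mn0; rewrite lt_min => /andP[? ?];
      apply/fintype.subsetP => i; rewrite !inE => /orP[]/eqP ->; rewrite gt_eqF.
have pD x : cone (subdivide u v D) x -> cone D (p x).
  move=> [x0]; rewrite !inE lpart_supp => /and3P[lD _ /implyP w].
  have e0 i : 0 <= e ord0 i by rewrite eE.
  split=> [i|]; first by rewrite !mxE addr_ge0 // mulr_ge0.
  have [w0|wn0] := eqVneq (x ord0 (rshift m ord0)) 0.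
    by rewrite /p w0 scale0r addr0.
  apply: dD.2 (w wn0) _; apply/fintype.subsetP => i; rewrite !inE !mxE.
  by case: (i == u); case: (i == v) => //=; rewrite mulr0 addr0.
have pK x : cone (subdivide u v D) x -> q (p x) = x.
  move=> [x0]; rewrite !inE lpart_supp => /and3P[_ uvs _].
  (* In the subdivided cone [x] vanishes at u or at v. After adding the mass of w to both
     coordinates, their minimum is exactly that mass. *)
  have mnp : mn (p x) = x ord0 (rshift m ord0).
    rewrite /mn /p !mxE !eqxx orbT !mulr1 -addr_minl.
    suff -> : Num.min (x ord0 (lshift 1 u)) (x ord0 (lshift 1 v)) = 0 by rewrite add0r.
    have [i] := fintype.subsetPn uvs; rewrite !inE mxE negbK => /orP[]/eqP -> /eqP ->.
      by rewrite min_l.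
    by rewrite min_r.
  rewrite /q mnp /p addrK -[RHS]hsubmxK; congr row_mx.
  by apply/rowP => i; rewrite !mxE (ord1 i).
exists (f \o p), (q \o g); split.
- by split=> x; apply: continuous_comp; [exact: cp|exact: cf|exact: cg|exact: cq].
- by split=> c x c0 /=; rewrite ?hp ?hf ?hg ?hq.
- by move=> y; apply: qD.
- by move=> y; rewrite /= qK gK.
- by move=> x cx; rewrite /= fK ?pK //; exact: pD.
Qed.

(** The first set consists of the faces avoiding the new vertex, the second of the traces on the old
    vertices of faces containing it. *)
Lemma faces_subdivide (m a : nat) (u v : 'I_m) (D : {set {set 'I_m}}) :
  down_closed D ->
  (#|[set s in D | (#|s| == a.+1) && ~~ ([set u; v] \subset s)]%SET| +
   #|[set s : {set 'I_m} | [&& #|s| == a, ~~ ([set u; v] \subset s) &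
                             [set u; v] :|: s \in D]]%SET|
   <= faces (subdivide u v D) a.+1)%N.
Proof.
(* [T0] and [T1] record absence and presence of the new vertex; tagging with them makes the two
   families disjoint. *)
move=> [_ dD]; set A := finset _; set B := finset _.
pose T0 : {set {set 'I_1}} := [set finset.set0]%SET.
pose T1 : {set {set 'I_1}} := [set [set ord0]]%SET.
have T01 : (finset.setX A T0 :&: finset.setX B T1 = finset.set0)%SET.
  apply/setP => -[s t]; rewrite !inE /=; apply/negP.
  move=> /andP[/andP[_ /eqP ->] /andP[_ /eqP /setP/(_ ord0)]].
  by rewrite !inE eqxx.
have -> : (#|A| + #|B| = #|finset.setX A T0 :|: finset.setX B T1|)%N.
  by rewrite cardsU T01 cards0 subn0 !cardsX !cards1 !muln1.
rewrite -(card_imset _ (@join_set_inj m 1)); apply: subset_leq_card.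
apply/fintype.subsetP => w /imsetP[[s t]]; rewrite !inE /= => st ->.
have wE : (rshift m ord0 \in join_set s t) = (ord0 \in t).
  by rewrite -[in RHS](rpart_join_set s t) [RHS]inE.
rewrite lpart_join_set card_join_set wE.
case/orP: st => /andP[/and3P[]].
  by move=> -> /eqP -> -> /eqP ->; rewrite cards0 addn0 inE eqxx.
move=> /eqP -> -> Ds /eqP ->; rewrite cards1 addn1 eqxx andbT /= Ds implybT andbT.
by apply: dD Ds _; exact: finset.subsetUr.
Qed.

(** No old vertex is lost, and w is gained, seen as the empty trace. *)
Lemma faces_subdivide1 (m : nat) (u v : 'I_m) (D : {set {set 'I_m}}) :
  down_closed D -> u != v -> [set u; v]%SET \in D ->
  (faces D 1 < faces (subdivide u v D) 1)%N.
Proof.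
move=> dD uv uvD; apply: leq_trans (faces_subdivide 0 u v dD).
rewrite -addn1; apply: leq_add.
  apply: subset_leq_card; apply/fintype.subsetP => s; rewrite !inE => /andP[-> s1].
  rewrite s1 /=; apply/negP => /subset_leq_card.
  by rewrite cards2 uv (eqP s1).
rewrite card_gt0; apply/set0Pn; exists finset.set0.
rewrite !inE cards0 eqxx finset.setU0 uvD andbT /=.
by apply/fintype.subsetPn; exists u; rewrite !inE ?eqxx.
Qed.

(** The edge uv is lost, but the two edges uw and vw are gained. *)
Lemma faces_subdivide2 (m : nat) (u v : 'I_m) (D : {set {set 'I_m}}) :
  down_closed D -> u != v -> [set u; v]%SET \in D ->
  (faces D 2 < faces (subdivide u v D) 2)%N.
Proof.
move=> dD uv uvD; apply: leq_trans (faces_subdivide 1 u v dD).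
have uvE : [set u; v]%SET \in [set s in D | #|s| == 2]%SET by rewrite inE uvD cards2 uv.
rewrite {1}/faces (cardsD1 [set u; v]%SET) uvE add1n -addn2; apply: leq_add.
  apply: subset_leq_card; apply/fintype.subsetP => s; rewrite !inE => /and3P[sn -> s2].
  rewrite s2 /=; apply: contra sn => uvs.
  by rewrite eq_sym finset.eqEcard uvs cards2 uv (eqP s2).
apply: (@leq_trans #|[set [set u]; [set v]]%SET|).
  by rewrite cards2 (inj_eq (@finset.set1_inj _)) uv.
apply: subset_leq_card; apply/fintype.subsetP => s; rewrite !inE.
case/orP => /eqP ->; rewrite cards1 eqxx /=; apply/andP; split.
- by apply/fintype.subsetPn; exists v; rewrite !inE ?eqxx ?orbT // eq_sym.
- rewrite (finset.setUidPl _) //.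
  by apply/fintype.subsetP => i; rewrite !inE => /eqP ->; rewrite eqxx.
- by apply/fintype.subsetPn; exists u; rewrite !inE ?eqxx.
- rewrite (finset.setUidPl _) //.
  by apply/fintype.subsetP => i; rewrite !inE => /eqP ->; rewrite eqxx orbT.
Qed.

(** * Joins of polygons *)

(** The 0-sphere as the boundary of a segment; joining with it is suspension. *)
Definition two_points : {set {set 'I_2}} := [set s | s != [set: 'I_2]]%SET.

Lemma down_closed_two_points : down_closed two_points.
Proof.
split=> [|s t]; rewrite !inE.
  by apply/eqP => /setP/(_ ord0); rewrite !inE.
move=> sT ts; apply: contra sT => /eqP tT.
by rewrite finset.eqEsubset finset.subsetT -tT.
Qed.

Lemma faces_two_points : faces two_points 1 = 2.
Proof.
rewrite -[RHS](bin1 2) -[in RHS](card_ord 2) -card_draws /faces.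
congr (#|pred_of_set _|); apply/setP => s; rewrite !inE andbC.
case: eqP => //= s1; apply/eqP => sT.
by move: s1; rewrite sT cardsT card_ord.
Qed.

(** The cone is a pair of half-axes, which [f] unfolds to a line; [g] takes the positive and
    negative parts of a number. *)
Lemma cone_space_two_points (R : realType) : cone_space R two_points 1.
Proof.
pose f (x : 'rV[R]_2) : 'rV[R]_1 := \row_j (x ord0 ord0 - x ord0 ord_max).
pose g (y : 'rV[R]_1) : 'rV[R]_2 :=
  \row_i (Num.max (if i == ord0 then y ord0 ord0 else - y ord0 ord0) 0).
have cf : continuous f.
  move=> x; apply: continuous_row => j.
  rewrite (_ : (fun t : 'rV[R]_2 => _) =
      (fun t : 'rV[R]_2 => t ord0 ord0 - t ord0 ord_max)).
    exact: (cvgB (@coord_continuous R 1 2 ord0 ord0 x)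
      (@coord_continuous R 1 2 ord0 ord_max x)).
  by apply: funext => t; rewrite mxE.
have cg : continuous g.
  move=> y; apply: continuous_row => i.
  have cy := @coord_continuous R 1 1 ord0 ord0 y.
  rewrite (_ : (fun t : 'rV[R]_1 => _) = (fun t : 'rV[R]_1 =>
    Num.max (if i == ord0 then t ord0 ord0 else - t ord0 ord0) 0)); last first.
    by apply: funext => t; rewrite mxE.
  apply: (@continuous_max R _ (fun t : 'rV[R]_1 =>
    if i == ord0 then t ord0 ord0 else - t ord0 ord0) (fun=> 0)).
    by case: (i == ord0); [exact: cy|exact: (cvgN cy)].
  exact: cst_continuous.
exists f, g; split=> //.
- split=> c x c0; apply/rowP => i; rewrite !mxE ?mulrBr //.
  by rewrite maxr_pMr // mulr0 (fun_if ( *%R c)) mulrN.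
- move=> y; split=> [i|]; first by rewrite mxE le_max lexx orbT.
  rewrite inE; apply/eqP => /setP h.
  have := h ord0; have := h ord_max; rewrite !inE !mxE /=.
  have [y0|/ltW y0] := leP (y ord0 ord0) 0; first by rewrite eqxx.
  by rewrite (@max_r _ _ (- _)) ?oppr_le0 // eqxx.
- move=> y; apply/rowP => j; rewrite !mxE /= (ord1 j).
  by case: (ltP (y 0 0) 0) => y0; case: ltP => y1; move: y0 y1; lra.
- move=> x [x0]; rewrite inE => sx; apply/rowP => i.
  have := x0 ord0; have := x0 ord_max.
  have : x ord0 ord0 = 0 \/ x ord0 ord_max = 0.
    have [e|n0] := eqVneq (x ord0 ord0) 0; first by left.
    have [e|n1] := eqVneq (x ord0 ord_max) 0; first by right.
    case/eqP: sx; apply/setP => k; rewrite !inE.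
    case: (unliftP ord0 k) => [k'|] -> //; rewrite (_ : lift _ _ = ord_max) //.
    by apply: val_inj; rewrite /= (ord1 k').
  move=> e h1 h0; rewrite !mxE; case: (unliftP ord0 i) => [k|] ->.
    rewrite (_ : lift _ _ = ord_max) /=; last by apply: val_inj; rewrite /= (ord1 k).
    by case: e => e; case: ltP; rewrite e; lra.
  by rewrite eqxx; case: e => e; case: ltP; rewrite e; lra.
Qed.

(** The join of two 0-spheres is a quadrilateral, and each edge subdivision adds a vertex. The
    strict bound on edges ensures that there is one to subdivide. *)
Lemma exists_polygon (R : realType) (p : nat) :
  exists (m : nat) (D : {set {set 'I_m}}),
    [/\ m = (p + 4)%N, down_closed D, cone_space R D 2,
        (p <= faces D 1)%N & (p < faces D 2)%N].
Proof.
elim: p => [|p [m [D [mE dD cD f1 f2]]]].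
  exists (2 + 2)%N, (join two_points two_points); split=> //.
  - exact: down_closed_join down_closed_two_points down_closed_two_points.
  - exact: cone_space_join (cone_space_two_points R) (cone_space_two_points R).
  - by apply: leq_trans (faces_join 1 1 _ _); rewrite faces_two_points.
have : (0 < faces D 2)%N by apply: leq_ltn_trans f2.
rewrite card_gt0 => /set0Pn[s]; rewrite inE => /andP[sD /cards2P[u [v [uv sE]]]].
rewrite sE in sD.
exists (m + 1)%N, (subdivide u v D); split.
- by rewrite mE addn1 addSn.
- exact: down_closed_subdivide.
- exact: cone_space_subdivide.
- by apply: leq_ltn_trans f1 _; exact: faces_subdivide1.
- by apply: leq_ltn_trans f2 _; exact: faces_subdivide2.
Qed.

Lemma exists_join_polygons (R : realType) (p k : nat) :
  exists (m : nat) (D : {set {set 'I_m}}),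
    [/\ m = (k * (p + 4))%N, down_closed D, cone_space R D k.*2 &
        forall t, (t <= k.*2)%N -> (p ^ minn t k <= faces D t)%N].
Proof.
have [q [P [qE dP cP P1 P2]]] := exists_polygon R p.
elim: k => [|k [m [D [mE dD cD fD]]]].
  (* The empty join has only the empty face, and its cone is the single point of the
     zero-dimensional space. *)
  exists 0, [set finset.set0]%SET.
  have d0 : down_closed [set finset.set0 : {set 'I_0}]%SET.
    split=> [|s t]; rewrite !inE // => _ _.
    by apply/eqP/setP => -[].
  split=> // [|t].
    exists id, id; split=> //.
    + by split=> x; exact: cvg_id.
    + move=> y; split=> [[]//|]; rewrite inE; by apply/eqP/setP => -[].
  by rewrite leqn0 => /eqP ->; rewrite faces0.
exists (q + m)%N, (join P D); split.
- by rewrite qE mE.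
- exact: down_closed_join.
- exact: (cone_space_join cP cD).
- move=> t tk; have [t0|t0] := posnP t.
    by rewrite t0 faces0 //; exact: down_closed_join.
  (* For t at most k + 1, the new polygon contributes a vertex. For larger t it contributes an edge,
     and t - 2 is still at least k, so the full exponent k is available in the rest. *)
  have [tk1|tk1] := leqP t k.+1.
    have tE : t = (1 + t.-1)%N by lia.
    rewrite tE expnD expn1.
    apply: leq_trans (faces_join 1 t.-1 P D); apply: leq_mul => //.
    by have := fD t.-1; rewrite (minn_idPl _) //; [apply|]; lia.
  have tE : t = (2 + t.-2)%N by lia.
  rewrite expnS tE.
  apply: leq_trans (faces_join 2 t.-2 P D); apply: leq_mul; first exact: ltnW.
  by have := fD t.-2; rewrite (minn_idPr _) //; [apply|]; lia.
Qed.

(** For odd n + 1 the polygons fall one dimension short, and a suspension supplies it at the cost of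
    two more vertices. *)
Lemma exists_sphere_cone (R : realType) (p n : nat) :
  exists (m : nat) (D : {set {set 'I_m}}),
    [/\ (m <= n.+1./2 * (p + 4) + 2)%N, down_closed D, cone_space R D n.+1 &
        forall t, (t <= n.+1)%N -> (p ^ minn t n.+1./2 <= faces D t)%N].
Proof.
have [m [D [mE dD cD fD]]] := exists_join_polygons R p n.+1./2.
move: mE cD fD; have := odd_double_half n.+1; set k := n.+1./2.
case: (odd n.+1) => /= nE mE cD fD; last first.
  by exists m, D; split; rewrite -?nE // [X in (X <= _)%N]mE leq_addr.
have dJ := down_closed_join down_closed_two_points dD.
exists (2 + m)%N, (join two_points D); split=> //.
- by rewrite mE addnC.
- by rewrite -nE; exact: (cone_space_join (cone_space_two_points R) cD).
- move=> t tn; have [tk|tk] := leqP t k.*2.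
    apply: leq_trans (faces_join 0 t _ _).
    by rewrite faces0 ?mul1n ?fD //; exact: down_closed_two_points.
  (* Only the facets remain: a suspension point joined to a facet of the join of polygons. *)
  have -> : t = (1 + k.*2)%N by lia.
  apply: leq_trans (faces_join 1 k.*2 _ _); rewrite faces_two_points.
  have := fD _ (leqnn _); rewrite !(minn_idPr _); lia.
Qed.

(** * Choice of the polygon size and estimate of the ratios *)

Theorem theorem2 (R : realType) (n : nat) (C : R) (hn : (3 <= n)%N) (hC : 0 < C) :
  exists (m : nat) (K : {set {set 'I_m}}),
    triangulates_sphere R n K /\
    forall i j : nat, (i < j)%N -> (j <= n)%N -> (i < (n - 1) %/ 2)%N ->
      C < (fvec K j)%:R / (fvec K i)%:R.
Proof.
(* [A] bounds the ratio of [m ^ i.+1] to [p ^ i.+1] for all relevant i. Taking p at least 4 gives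
   [p + 4 <= 2 * p], hence [m <= (2 * k + 2) * p]. *)
pose k := n.+1./2; pose A := ((2 * k + 2) ^ k)%N.
have CA0 : 0 <= C * A%:R by rewrite mulr_ge0 ?ler0n // ltW.
pose p := (Num.bound (C * A%:R) + 4)%N.
have CAp : C * A%:R < p%:R.
  by apply: lt_le_trans (archi_boundP CA0) _; rewrite ler_nat leq_addr.
have p4 : (4 <= p)%N by rewrite leq_addl.
have [m [D [mle dD cD fD]]] := exists_sphere_cone R p n.
exists m, (D :\ finset.set0)%SET; split; first exact: cone_space_sphere.
move=> i j ij jn ik; rewrite !fvecD1.
have ik2 : (i.+2 <= k)%N by rewrite /k; lia.
(* As i + 2 is at most k, a face of dimension above i has enough vertices to give one power of p
   more than the upper bound [hi] allows in dimension i. *)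
have lo t : (i < t)%N -> (t <= n)%N -> (p ^ i.+2 <= faces D t.+1)%N.
  move=> it tn; apply: leq_trans (fD _ _) => //.
  by rewrite leq_pexp2l ?leq_min; lia.
(* Division by zero would yield 0, so the denominator must be positive before clearing it. *)
have fi0 : (0 < faces D i.+1)%N.
  by apply: leq_trans (fD _ _); rewrite ?expn_gt0; lia.
have hi : (faces D i.+1 <= A * p ^ i.+1)%N.
  apply: leq_trans (faces_le _ _) _.
  apply: (@leq_trans (((2 * k + 2) * p) ^ i.+1)).
    rewrite leq_exp2r //; apply: leq_trans mle _; rewrite -/k; nia.
  rewrite expnMn leq_mul2r leq_pexp2l ?orbT //; lia.
rewrite ltr_pdivlMr ?ltr0n //.
apply: (@le_lt_trans _ _ (C * A%:R * (p ^ i.+1)%:R)).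
  by rewrite -mulrA -natrM ler_pM2l // ler_nat.
apply: (@lt_le_trans _ _ (p%:R * (p ^ i.+1)%:R)).
  by rewrite ltr_pM2r // ltr0n expn_gt0; lia.
by rewrite -natrM -expnS ler_nat lo.
Qed.
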